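(* Let $K$ be a field and let $E$ be a directed graph. Consider $L_K(E)$, the Leavitt path $K$-algebra of $E$ with coefficients in $K$. The following five assertions are equivalent: (i) $E$ is finite and acyclic; (ii) $L_K(E)$ is left artinian; (iii) $L_K(E)$ is right artinian; (iv) $L_K(E)$ is artinian; (v) $L_K(E)$ is unital and semisimple.
   Context: A directed graph $E=(E^0,E^1,r,s)$ consists of two countable sets $E^0$ (whose elements are called vertices) and $E^1$ (whose elements are called edges) and maps $r,s:E^1\to E^0$. $E$ is finite if both $E^0$ and $E^1$ are finite sets. A path $\mu$ in $E$ is a sequence of edges $\mu=\mu_1\cdots\mu_n$ such that $r(\mu_i)=s(\mu_{i+1})$ for $i\in\{1,\ldots,n-1\}$; in that case $s(\mu):=s(\mu_1)$ is its source and $r(\mu):=r(\mu_n)$ is its range. A path $\mu$ is called a cycle if $s(\mu)=r(\mu)$ and $s(\mu_i)\neq s(\mu_j)$ for every $i\neq j$. A graph without cycles is said to be acyclic. The Leavitt path algebra $L_K(E)$ is the (associative, not necessarily unital) $K$-algebra generated by a set $\{v : v\in E^0\}$ of pairwise orthogonal idempotents, together with a set of variables $\{f : f\in E^1\}\cup\{f^* : f\in E^1\}$, which satisfy the following relations: (1) $s(f)f=fr(f)=f$ for all $f\in E^1$; (2) $r(f)f^*=f^*s(f)=f^*$ for all $f\in E^1$; (3) $f^*f'=\delta_{f,f'}r(f)$ for all $f,f'\in E^1$, where $\delta_{f,f'}$ is the Kronecker delta; (4) $v=\sum_{\{f\in E^1 \,:\, s(f)=v\}}ff^*$ for every $v\in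 E^0$ for which $s^{-1}(v)$ is non-empty and finite. A ring is left (right) artinian if it satisfies the descending chain condition on left (right) submodules of itself, i.e. on additive subgroups closed under left (right) multiplication by elements of the ring; it is artinian if it is both left and right artinian. A ring is unital if it has a multiplicative identity, which is always assumed to be non-zero. ''Ideal'' means two-sided ideal. A ring $R$ is simple if $\{0\}$ and $R$ are its only ideals, and a ring is semisimple if it is a finite direct sum of simple rings.
   Formalization: Semisimple is taken to mean a finite direct sum of simple artinian rings (with merely simple summands, one vertex with two loops is a counterexample), and (v) is linked to (i)–(iv) only for graphs with at least one vertex (the empty graph gives the zero ring). *)

(* Defs.v *)
From HB Require Import structures.
From mathcomp Require Import all_boot all_order all_algebra generic_quotient.
From mathcomp Require Import boolp classical_sets functions cardinality.

Set Implicit Arguments.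
Unset Strict Implicit.
Unset Printing Implicit Defensive.

Import GRing.Theory.

Local Open Scope classical_set_scope.
Local Open Scope quotient_scope.
Local Open Scope ring_scope.

(* Associative rings, not necessarily unital. *)

HB.mixin Record Zmodule_isRng R of GRing.Zmodule R := {
  rmul : R -> R -> R;
  rmulA : associative rmul;
  rmulDl : left_distributive rmul +%R;
  rmulDr : right_distributive rmul +%R;
}.

#[short(type="rngType")]
HB.structure Definition Rng := {R of Zmodule_isRng R & GRing.Zmodule R}.

Section RngNotions.
Variable R : rngType.
Implicit Type I : set R.

Definition additive_subgroup I :=
  I 0 /\ forall x y, I x -> I y -> I (x - y).

Definition left_ideal I :=
  additive_subgroup I /\ forall r x, I x -> I (rmul r x).

Definition right_ideal I :=
  additive_subgroup I /\ forall r x, I x -> I (rmul x r).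

Definition two_sided_ideal I := left_ideal I /\ right_ideal I.

Definition descending_chain_condition (P : set R -> Prop) :=
  forall I : nat -> set R,
    (forall n, P (I n)) -> (forall n, I n.+1 `<=` I n) ->
    exists N, forall n, (N <= n)%N -> I n = I N.

Definition left_artinian := descending_chain_condition left_ideal.
Definition right_artinian := descending_chain_condition right_ideal.
Definition artinian := left_artinian /\ right_artinian.

Definition unital :=
  exists e : R, e <> 0 /\ forall x, rmul e x = x /\ rmul x e = x.

Definition simple :=
  forall I, two_sided_ideal I -> I = [set 0] \/ I = setT.

End RngNotions.

Arguments left_artinian : clear implicits.
Arguments right_artinian : clear implicits.
Arguments artinian : clear implicits.
Arguments unital : clear implicits.
Arguments simple : clear implicits.

(* Semisimple in the sense of the Wedderburn-Artin theorem: [R] is isomorphic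
   to a finite direct sum of simple artinian rings.  The descending chain
   condition on the summands cannot be dropped: the Leavitt path algebra of the
   graph with one vertex and two loops is unital and has no ideals but {0} and
   itself, although it is not artinian and its graph is not acyclic. *)
Definition semisimple (R : rngType) :=
  exists (n : nat) (S : 'I_n -> rngType) (phi : R -> forall i, S i),
    [/\ forall i, simple (S i) /\ artinian (S i),
        forall x y i, phi (x + y) i = phi x i + phi y i,
        forall x y i, phi (rmul x y) i = rmul (phi x i) (phi y i) &
        bijective phi].

Record digraph := Digraph {
  vertex : countType;
  edge : countType;
  src : edge -> vertex;
  rng : edge -> vertex;
}.

Section Graph.
Variable E : digraph.

Definition finite_graph :=
  finite_set [set: vertex E] /\ finite_set [set: edge E].

Definition is_path (mu : seq (edge E)) : bool :=
  if mu is e :: p then path (fun f g => rng f == src g) e p else false.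

Definition is_cycle (mu : seq (edge E)) : bool :=
  if mu is e :: p then
    [&& is_path mu, src e == rng (last e p) & uniq (map (@src E) mu)]
  else false.

Definition acyclic := forall mu, ~~ is_cycle mu.

End Graph.

Arguments finite_graph : clear implicits.
Arguments acyclic : clear implicits.

(* The Leavitt path algebra is the non-unital K-algebra given by the generators
   and relations: formal expressions in the generators, modulo the smallest
   congruence that contains the algebra axioms and the defining relations. *)
Section LeavittPathAlgebra.
Variables (K : fieldType) (E : digraph).

Inductive lterm : Type :=
| LVertex of vertex E
| LEdge of edge E
| LGhost of edge E  (* f^* *)
| LZero
| LOpp of lterm
| LAdd of lterm & lterm
| LScale of K & lterm
| LMul of lterm & lterm.

Definition lsum (ts : seq lterm) : lterm := foldr LAdd LZero ts.

Inductive lcong : lterm -> lterm -> Prop :=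
| lcong_refl x : lcong x x
| lcong_sym x y : lcong x y -> lcong y x
| lcong_trans x y z : lcong x y -> lcong y z -> lcong x z
| lcong_opp x x' : lcong x x' -> lcong (LOpp x) (LOpp x')
| lcong_add x x' y y' :
    lcong x x' -> lcong y y' -> lcong (LAdd x y) (LAdd x' y')
| lcong_scale a x x' : lcong x x' -> lcong (LScale a x) (LScale a x')
| lcong_mul x x' y y' :
    lcong x x' -> lcong y y' -> lcong (LMul x y) (LMul x' y')
| lcong_addA x y z : lcong (LAdd x (LAdd y z)) (LAdd (LAdd x y) z)
| lcong_addC x y : lcong (LAdd x y) (LAdd y x)
| lcong_add0 x : lcong (LAdd LZero x) x
| lcong_addN x : lcong (LAdd (LOpp x) x) LZero
| lcong_scaleA a b x : lcong (LScale a (LScale b x)) (LScale (a * b) x)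
| lcong_scale1 x : lcong (LScale 1 x) x
| lcong_scaleDr a x y :
    lcong (LScale a (LAdd x y)) (LAdd (LScale a x) (LScale a y))
| lcong_scaleDl a b x :
    lcong (LScale (a + b) x) (LAdd (LScale a x) (LScale b x))
| lcong_mulA x y z : lcong (LMul x (LMul y z)) (LMul (LMul x y) z)
| lcong_mulDl x y z : lcong (LMul (LAdd x y) z) (LAdd (LMul x z) (LMul y z))
| lcong_mulDr x y z : lcong (LMul x (LAdd y z)) (LAdd (LMul x y) (LMul x z))
| lcong_scaleAl a x y : lcong (LScale a (LMul x y)) (LMul (LScale a x) y)
| lcong_scaleAr a x y : lcong (LScale a (LMul x y)) (LMul x (LScale a y))
| lcong_idem v : lcong (LMul (LVertex v) (LVertex v)) (LVertex v)
| lcong_orth v w : v <> w -> lcong (LMul (LVertex v) (LVertex w)) LZero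
| lcong_src_edge f : lcong (LMul (LVertex (src f)) (LEdge f)) (LEdge f)
| lcong_edge_rng f : lcong (LMul (LEdge f) (LVertex (rng f))) (LEdge f)
| lcong_rng_ghost f : lcong (LMul (LVertex (rng f)) (LGhost f)) (LGhost f)
| lcong_ghost_src f : lcong (LMul (LGhost f) (LVertex (src f))) (LGhost f)
| lcong_CK1_eq f : lcong (LMul (LGhost f) (LEdge f)) (LVertex (rng f))
| lcong_CK1_neq f g : f <> g -> lcong (LMul (LGhost f) (LEdge g)) LZero
(* [fs] lists s^{-1}(v) without repetition, so s^{-1}(v) is finite. *)
| lcong_CK2 v (fs : seq (edge E)) :
    uniq fs -> (forall f, f \in fs <-> src f = v) -> fs <> [::] ->
    lcong (LVertex v) (lsum [seq LMul (LEdge f) (LGhost f) | f <- fs]).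

HB.instance Definition _ := gen_eqMixin lterm.
HB.instance Definition _ := gen_choiceMixin lterm.

Definition lcongb (x y : lterm) : bool := `[< lcong x y >].

Lemma lcongb_refl : reflexive lcongb.
Proof. by move=> x; apply/asboolP; exact: lcong_refl. Qed.

Lemma lcongb_sym : symmetric lcongb.
Proof. by move=> x y; apply/asboolP/asboolP; exact: lcong_sym. Qed.

Lemma lcongb_trans : transitive lcongb.
Proof.
by move=> y x z /asboolP xy /asboolP yz; apply/asboolP; exact: lcong_trans yz.
Qed.

Canonical lcong_equiv := EquivRel lcongb lcongb_refl lcongb_sym lcongb_trans.

Definition LPA : Type := {eq_quot lcong_equiv}.

HB.instance Definition _ := Choice.on LPA.

Definition lpa_class (t : lterm) : LPA := \pi_({eq_quot lcong_equiv}) t.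
Definition lpa_repr (a : LPA) : lterm :=
  repr (a : {eq_quot lcong_equiv}).

Lemma lpa_classP x y : lpa_class x = lpa_class y <-> lcong x y.
Proof.
by split=> [/eqmodP/asboolP|xy] //; apply/eqmodP/asboolP.
Qed.

Lemma lpa_reprK a : lpa_class (lpa_repr a) = a.
Proof. exact: reprK. Qed.

Lemma lpa_repr_class x : lcong (lpa_repr (lpa_class x)) x.
Proof. by apply/lpa_classP; rewrite lpa_reprK. Qed.

Lemma lpa_ind (P : LPA -> Prop) : (forall x, P (lpa_class x)) -> forall a, P a.
Proof. by move=> h a; rewrite -(lpa_reprK a). Qed.

Definition lpa_opp (a : LPA) : LPA := lpa_class (LOpp (lpa_repr a)).
Definition lpa_add (a b : LPA) : LPA :=
  lpa_class (LAdd (lpa_repr a) (lpa_repr b)).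
Definition lpa_scale (k : K) (a : LPA) : LPA :=
  lpa_class (LScale k (lpa_repr a)).
Definition lpa_mul (a b : LPA) : LPA :=
  lpa_class (LMul (lpa_repr a) (lpa_repr b)).

Lemma lpa_oppE x : lpa_opp (lpa_class x) = lpa_class (LOpp x).
Proof. by apply/lpa_classP/lcong_opp/lpa_repr_class. Qed.

Lemma lpa_addE x y :
  lpa_add (lpa_class x) (lpa_class y) = lpa_class (LAdd x y).
Proof. by apply/lpa_classP/lcong_add; exact: lpa_repr_class. Qed.

Lemma lpa_scaleE k x : lpa_scale k (lpa_class x) = lpa_class (LScale k x).
Proof. by apply/lpa_classP/lcong_scale/lpa_repr_class. Qed.

Lemma lpa_mulE x y :
  lpa_mul (lpa_class x) (lpa_class y) = lpa_class (LMul x y).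
Proof. by apply/lpa_classP/lcong_mul; exact: lpa_repr_class. Qed.

Let lpaE := (lpa_oppE, lpa_addE, lpa_scaleE, lpa_mulE).

Lemma lpa_addA : associative lpa_add.
Proof.
elim/lpa_ind=> x; elim/lpa_ind=> y; elim/lpa_ind=> z; rewrite !lpaE.
exact/lpa_classP/lcong_addA.
Qed.

Lemma lpa_addC : commutative lpa_add.
Proof.
elim/lpa_ind=> x; elim/lpa_ind=> y; rewrite !lpaE.
exact/lpa_classP/lcong_addC.
Qed.

Lemma lpa_add0 : left_id (lpa_class LZero) lpa_add.
Proof. by elim/lpa_ind=> x; rewrite !lpaE; exact/lpa_classP/lcong_add0. Qed.

Lemma lpa_addN : left_inverse (lpa_class LZero) lpa_opp lpa_add.
Proof. by elim/lpa_ind=> x; rewrite !lpaE; exact/lpa_classP/lcong_addN. Qed.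

HB.instance Definition _ :=
  GRing.isZmodule.Build LPA lpa_addA lpa_addC lpa_add0 lpa_addN.

Lemma lpa_scaleA a b x : lpa_scale a (lpa_scale b x) = lpa_scale (a * b) x.
Proof.
by elim/lpa_ind: x => x; rewrite !lpaE; exact/lpa_classP/lcong_scaleA.
Qed.

Lemma lpa_scale1 : left_id 1 lpa_scale.
Proof. by elim/lpa_ind=> x; rewrite !lpaE; exact/lpa_classP/lcong_scale1. Qed.

Lemma lpa_scaleDr : right_distributive lpa_scale +%R.
Proof.
move=> a; elim/lpa_ind=> x; elim/lpa_ind=> y; rewrite /+%R /= !lpaE.
exact/lpa_classP/lcong_scaleDr.
Qed.

Lemma lpa_scaleDl x a b :
  lpa_scale (a + b) x = lpa_scale a x + lpa_scale b x.
Proof.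
elim/lpa_ind: x => x; rewrite [RHS]/+%R /= !lpaE.
exact/lpa_classP/lcong_scaleDl.
Qed.

HB.instance Definition _ := GRing.Zmodule_isLmodule.Build K LPA
  lpa_scaleA lpa_scale1 lpa_scaleDr (fun x a b => lpa_scaleDl x a b).

Lemma lpa_mulA : associative lpa_mul.
Proof.
elim/lpa_ind=> x; elim/lpa_ind=> y; elim/lpa_ind=> z; rewrite !lpaE.
exact/lpa_classP/lcong_mulA.
Qed.

Lemma lpa_mulDl : left_distributive lpa_mul +%R.
Proof.
elim/lpa_ind=> x; elim/lpa_ind=> y; elim/lpa_ind=> z; rewrite /+%R /= !lpaE.
exact/lpa_classP/lcong_mulDl.
Qed.

Lemma lpa_mulDr : right_distributive lpa_mul +%R.
Proof.
elim/lpa_ind=> x; elim/lpa_ind=> y; elim/lpa_ind=> z; rewrite /+%R /= !lpaE.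
exact/lpa_classP/lcong_mulDr.
Qed.

HB.instance Definition _ := Zmodule_isRng.Build LPA
  lpa_mulA lpa_mulDl lpa_mulDr.

Lemma lpa_scaleAl (a : K) (x y : LPA) : a *: rmul x y = rmul (a *: x) y.
Proof.
elim/lpa_ind: x => x; elim/lpa_ind: y => y.
rewrite /rmul /= /GRing.scale /= !lpaE; exact/lpa_classP/lcong_scaleAl.
Qed.

Lemma lpa_scaleAr (a : K) (x y : LPA) : a *: rmul x y = rmul x (a *: y).
Proof.
elim/lpa_ind: x => x; elim/lpa_ind: y => y.
rewrite /rmul /= /GRing.scale /= !lpaE; exact/lpa_classP/lcong_scaleAr.
Qed.

End LeavittPathAlgebra.

(* Main.v *)
(** If [L_K(E)] is right artinian then [E] is finite, since infinitely many
    vertices [v_n] (resp. edges [f_n]) give a strictly decreasing chain of right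
    annihilators of [v_0, ..., v_(n-1)] (resp. of the [f_k^*]).  It is acyclic:
    if [c] is a cycle at [v] and [t = v - c], the chain [t^n L] is strictly
    decreasing.  To see this, let [L_K(E)] act on functions with values in
    [K[[T]]] on a branching system of [E], in such a way that [c] multiplies the
    value at the point [c c c ...] by the unit [1 - T]; then [t] multiplies that
    value by [T].  The same module shows that vertices are nonzero.

    If [E] is finite and acyclic, iterating (4) gives
    [1 = \sum a a^*] over the paths [a] ending at a sink, and [a^* b = \delta_ab]
    for such paths.  As [a^* x b] is always a scalar multiple of a sink, the
    [a b^*] are matrix units and [L_K(E)] is a product of matrix algebras, one
    for each sink.  A finite product of left artinian rings which has an identity
    is left artinian.  The involution [*] exchanges left and right ideals. *)

Require Import Defs.
From HB Require Import structures.
From mathcomp Require Import all_boot all_order all_algebra.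
From mathcomp Require Import boolp classical_sets functions cardinality.

Set Implicit Arguments.
Unset Strict Implicit.
Unset Printing Implicit Defensive.

Import GRing.Theory.

Local Open Scope classical_set_scope.
Local Open Scope ring_scope.

Local Notation "x ** y" := (rmul x y) (at level 40, left associativity).

(** * Rings without identity and chains of right ideals *)

Lemma subgroupD (V : zmodType) (I : set V) :
  I 0 -> (forall x y, I x -> I y -> I (x - y)) ->
  forall x y, I x -> I y -> I (x + y).
Proof.
by move=> I0 IB x y Ix Iy; rewrite -[y]opprK -[- y]sub0r; do 2?apply: (IB).
Qed.

Section RngTheory.
Variable R : rngType.
Implicit Types x y z : R.

Lemma rmul0r x : 0 ** x = 0 :> R.
Proof. by apply: (@addrI _ (0 ** x)); rewrite -rmulDl !addr0. Qed.

Lemma rmulr0 x : x ** 0 = 0 :> R.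
Proof. by apply: (@addrI _ (x ** 0)); rewrite -rmulDr !addr0. Qed.

Lemma rmulrN x y : x ** (- y) = - (x ** y).
Proof. by apply: (@addrI _ (x ** y)); rewrite -rmulDr !subrr rmulr0. Qed.

Lemma rmulBr x y z : z ** (x - y) = z ** x - z ** y.
Proof. by rewrite rmulDr rmulrN. Qed.

Lemma rmul_suml (I : Type) (r : seq I) (P : pred I) (F : I -> R) x :
  (\sum_(i <- r | P i) F i) ** x = \sum_(i <- r | P i) F i ** x.
Proof.
exact: (big_morph (fun y => y ** x) (fun a b => rmulDl a b x) (rmul0r x)).
Qed.

Lemma rmul_sumr (I : Type) (r : seq I) (P : pred I) (F : I -> R) x :
  x ** (\sum_(i <- r | P i) F i) = \sum_(i <- r | P i) x ** F i.
Proof. exact: (big_morph (rmul x) (fun a b => rmulDr x a b) (rmulr0 x)). Qed.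

Lemma right_annihilator_right_ideal (A : set R) :
  right_ideal [set x : R | forall a, A a -> a ** x = 0].
Proof.
split; first split => /= [a _|x y hx hy a Aa]; first exact: rmulr0.
  by rewrite rmulBr hx // hy // subrr.
by move=> r x hx a Aa; rewrite rmulA hx // rmul0r.
Qed.

(** [b n] lies in the right annihilator of [a 0, ..., a (n-1)] but not in the next one, so these
    annihilators never stabilise. *)
Lemma right_artinian_triangular (a b : nat -> R) :
  (forall k n, (k < n)%N -> a k ** b n = 0) -> (forall n, a n ** b n <> 0) ->
  ~ right_artinian R.
Proof.
move=> ab0 abN0 art.
pose A n : set R := [set a k | k in [set k | (k < n)%N]].
have [||N /(_ N.+1 (leqnSn N)) IN] := art
    (fun n => [set x : R | forall a, A n a -> a ** x = 0]).
- by move=> n; apply: right_annihilator_right_ideal.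
- by move=> n x /= hx _ [k kn <-]; apply: hx; exists k => //; apply: ltnW.
have: [set x : R | forall a, A N a -> a ** x = 0] (b N).
  by move=> _ [k kN <-]; apply: ab0.
by rewrite -IN => /(_ (a N)) bN; apply: (abN0 N); apply: bN; exists N => /=.
Qed.

Lemma iter_rmulB t n x y :
  iter n (rmul t) (x - y) = iter n (rmul t) x - iter n (rmul t) y.
Proof. by elim: n => //= n ->; rewrite rmulBr. Qed.

Lemma iter_rmulA t n x y : iter n (rmul t) x ** y = iter n (rmul t) (x ** y).
Proof. by elim: n => //= n <-; rewrite rmulA. Qed.

(** The right ideals [t^n R] stabilise. Powers are iterated left multiplications, so the chain
    starts at [R] itself without [t^0] having to exist. *)
Lemma right_artinian_powers t : right_artinian R ->
  exists N, forall x, exists y, iter N (rmul t) x = iter N.+1 (rmul t) y.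
Proof.
move=> art.
have [||N /(_ N.+1 (leqnSn N)) IN] := art
    (fun n => [set x : R | exists y, x = iter n (rmul t) y]).
- move=> n; split; [split|] => [|_ _ [x ->] [y ->]|r _ [x ->]].
  + exists 0; rewrite -[X in iter n _ X](subrr 0).
    by rewrite iter_rmulB subrr.
  + by exists (x - y); rewrite iter_rmulB.
  + by exists (x ** r); rewrite iter_rmulA.
- by move=> n _ [y ->]; exists (t ** y); rewrite -iterSr.
exists N => x.
have: [set z : R | exists y, z = iter N (rmul t) y] (iter N (rmul t) x).
  by exists x.
by rewrite -IN.
Qed.

End RngTheory.

(** * Finite products of left artinian rings *)

(** A left ideal is determined by its projections. With [e] split into its components [u i], an [x]
    that agrees at [i] with some [y] of the ideal has [u i ** x = u i ** y], and [x] is the sum of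
    these products. *)
Lemma left_artinian_prod (R : rngType) (n : nat) (S : 'I_n -> rngType)
    (phi : R -> forall i, S i) (e : R) :
  (forall x, e ** x = x) -> (forall i, left_artinian (S i)) ->
  (forall x y i, phi (x + y) i = phi x i + phi y i) ->
  (forall x y i, phi (x ** y) i = phi x i ** phi y i) ->
  bijective phi -> left_artinian R.
Proof.
move=> e1 artS phiD phiM [psi phiK psiK] I idI decI.
have phi0 i : phi 0 i = 0.
  by apply: (@addrI _ (phi 0 i)); rewrite -phiD !addr0.
have phiB x y i : phi (x - y) i = phi x i - phi y i.
  by apply: (@addIr _ (phi y i)); rewrite -phiD !subrK.
pose J k i : set (S i) := [set phi x i | x in I k].
have idJ k i : left_ideal (J k i).
  have [[I0 IB] IM] := idI k.
  split; [split|] => [|_ _ [x Ix <-] [y Iy <-]|r _ [x Ix <-]].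
  - by exists 0.
  - by exists (x - y); [apply: IB | apply: phiB].
  - exists (psi (dfwith (fun j : 'I_n => 0 : S j) r) ** x); first exact: IM.
    by rewrite phiM psiK dfwith_in.
pose u i : R := psi (dfwith (fun j : 'I_n => 0 : S j) (phi e i)).
have ue : e = \sum_i u i.
  rewrite -[LHS]phiK; apply: (can_inj phiK); rewrite psiK.
  apply: functional_extensionality_dep => j.
  have phi_sum : phi (\sum_i u i) j = \sum_i phi (u i) j.
    exact: (big_morph (fun x => phi x j) (fun a b => phiD a b j) (phi0 j)).
  rewrite phi_sum (bigD1 j) //= /u psiK dfwith_in big1 ?addr0 // => i ij.
  by rewrite psiK dfwith_out.
have memI k x : (forall i, J k i (phi x i)) -> I k x.
  move=> Jx; have [[I0 IB] IM] := idI k.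
  have ID := subgroupD I0 IB.
  rewrite -[x]e1 ue rmul_suml; elim/big_ind: _ => // i _.
  have [y Iy yx] := Jx i.
  suff -> : u i ** x = u i ** y by apply: IM.
  rewrite -[LHS]phiK -[RHS]phiK; congr psi.
  apply: functional_extensionality_dep => j; rewrite !phiM /u psiK.
  by case: dfwithP => [|l _] /=; [rewrite yx | rewrite !rmul0r].
have /choice[N JN] : forall i, exists N, forall k, (N <= k)%N -> J k i = J N i.
  move=> i; apply: artS => [k|k]; first exact: idJ.
  by move=> _ [x Ix <-]; exists x => //; apply: decI.
have Imono k l : (k <= l)%N -> I l `<=` I k.
  move=> /subnK <-; elim: (l - k)%N => // m IH; apply: subset_trans IH.
  exact: decI.
exists (\max_i N i) => k lek; apply/seteqP; split; first exact: Imono.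
move=> x Ix; apply: memI => i.
have leN : (N i <= \max_i N i)%N by apply: (leq_bigmax i).
by rewrite JN ?(leq_trans leN) // -(JN i _ leN); exists x.
Qed.

(** * Chains of subspaces *)

Section FiniteDimension.
Variables (K : fieldType) (V : vectType K).

(** A subspace [U] of maximal dimension inside [I] exhausts it, since otherwise the line through
    some [x] in [I] could be added. *)
Lemma subspace_vspace (I : set V) :
  I 0 -> (forall x y, I x -> I y -> I (x - y)) ->
  (forall k x, I x -> I (k *: x)) ->
  exists U : {vspace V}, I = [set x | x \in U].
Proof.
move=> I0 IB IZ.
have ID := subgroupD I0 IB.
pose P d := `[< exists U : {vspace V},
  [set x | x \in U] `<=` I /\ \dim U = d >].
have exP : exists d, P d.
  exists 0%N; apply/asboolP; exists 0%VS; split; last exact: dimv0.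
  by move=> x /=; rewrite memv0 => /eqP ->.
have Pbound d : P d -> (d <= \dim (fullv : {vspace V}))%N.
  by move=> /asboolP[U [_ <-]]; apply/dimvS/subvf.
case: (ex_maxnP exP Pbound) => d /asboolP[U [UI dU]] maxd.
exists U; apply/seteqP; split=> // x Ix; apply: contrapT => /= /negP xU.
have : (\dim (U + <[x]>) <= \dim U)%N.
  rewrite dU; apply/maxd/asboolP; exists (U + <[x]>)%VS; split => //.
  move=> _ /= /memv_addP[u uU [_ /vlineP[k ->] ->]].
  by apply: ID; [apply: UI | apply: IZ].
rewrite leqNgt => /negP; apply; rewrite ltnNge; apply/negP => le.
move/negP: xU; apply.
have /eqP -> : U == (U + <[x]>)%VS by rewrite eqEdim addvSl.
by apply: (subvP (addvSr U _)); apply: memv_line.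
Qed.

(** The chain is constant from a term of least dimension on. *)
Lemma subspace_dcc (I : nat -> set V) :
  (forall n, [/\ I n 0, forall x y, I n x -> I n y -> I n (x - y) &
     forall k x, I n x -> I n (k *: x)]) ->
  (forall n, I n.+1 `<=` I n) ->
  exists N, forall n, (N <= n)%N -> I n = I N.
Proof.
move=> subI decI.
have /choice[U IU] : forall n, exists U : {vspace V}, I n = [set x | x \in U].
  by move=> n; have [] := subI n; apply: subspace_vspace.
have Imono k l : (k <= l)%N -> I l `<=` I k.
  move=> /subnK <-; elim: (l - k)%N => // m IH; apply: subset_trans IH.
  exact: decI.
pose P d := `[< exists n, \dim (U n) = d >].
have exP : exists d, P d by exists (\dim (U 0)); apply/asboolP; exists 0.
case: (ex_minnP exP) => d /asboolP[N dN] mind.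
exists N => n leNn; rewrite !IU; suff -> : U n = U N by [].
apply/eqP; rewrite eqEdim dN; apply/andP; split.
  by apply/subvP => x; have := Imono _ _ leNn x; rewrite !IU.
by apply/mind/asboolP; exists n.
Qed.

End FiniteDimension.

(** * Matrix algebras *)

Section MatrixRng.
Variables (K : fieldType) (n : nat).

Definition mxrng := 'M[K]_n.

HB.instance Definition _ := GRing.Zmodule.on mxrng.
HB.instance Definition _ := Zmodule_isRng.Build mxrng
  (@mulmxA K n n n n) (@mulmxDl K n n n) (@mulmxDr K n n n).

(** Scaling is multiplication by a scalar matrix, so one-sided ideals are subspaces. *)
Lemma mxrng_artinian : artinian mxrng.
Proof.
split=> I idI decI; apply: (@subspace_dcc K 'M[K]_n I _ decI) => k;
  have [[I0 IB] IM] := idI k; split=> // a x Ix.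
- by rewrite -mul_scalar_mx; apply: (IM a%:M).
- by rewrite -mul_mx_scalar; apply: (IM a%:M).
Qed.

Lemma mxrng_simple : simple mxrng.
Proof.
move=> I [[[I0 IB] IL] [_ IR]].
have [I_0|/existsNP[M /not_implyP[IM MN0]]] :=
    pselect (forall M, I M -> M = 0).
  by left; apply/seteqP; split=> [M /I_0|_ ->].
right; apply/seteqP; split=> // A _.
have ID := subgroupD I0 IB.
have [i [j Mij]] : exists i j, M i j != 0.
  apply: contrapT => MN; apply: MN0; apply/matrixP => i j; rewrite mxE.
  by apply: contrapT => /eqP Mij; apply: MN; exists i, j.
rewrite (matrix_sum_delta A).
apply: (big_ind I) => // k _; apply: (big_ind I) => // l _.
(* Sandwiching [M] between matrix units isolates its nonzero entry [M i j], which puts every matrix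
   unit into [I]. *)
suff -> : A k l *: delta_mx k l =
    ((A k l / M i j) *: delta_mx k i : mxrng) ** M ** (delta_mx j l : mxrng).
  by apply: IR; apply: IL.
rewrite /rmul /= -scalemxAl -scalemxAl.
suff -> : delta_mx k i *m M *m delta_mx j l = M i j *: delta_mx k l.
  by rewrite scalerA divfK.
apply/matrixP => a b; rewrite !mxE (bigD1 j) //= !mxE (bigD1 i) //= !mxE.
rewrite !eqxx big1 ?addr0 => [|c /negbTE cj]; last first.
  by rewrite !mxE cj andbF mul0r.
rewrite big1 ?addr0 => [|c /negbTE cj]; last by rewrite !mxE cj mulr0.
by rewrite andbT /=; case: (a == k); case: (b == l);
  rewrite ?(mul1r, mul0r, mulr1, mulr0).
Qed.

End MatrixRng.

(** * Generators of the Leavitt path algebra and its involution *)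

Section Generators.
Variables (K : fieldType) (E : digraph).
Local Notation L := (LPA K E).

Definition lpaV (v : vertex E) : L := lpa_class (LVertex K v).
Definition lpaE (f : edge E) : L := lpa_class (LEdge K f).
Definition lpaG (f : edge E) : L := lpa_class (LGhost K f).

(** Opposites are covered by scaling by -1. *)
Lemma lpa_gen_ind (P : L -> Prop) :
  (forall v, P (lpaV v)) -> (forall f, P (lpaE f)) -> (forall f, P (lpaG f)) ->
  P 0 -> (forall x y, P x -> P y -> P (x + y)) ->
  (forall k x, P x -> P (k *: x)) ->
  (forall x y, P x -> P y -> P (x ** y)) -> forall x, P x.
Proof.
move=> PV PE PG P0 PD PZ PM; elim/lpa_ind; elim=> //.
- move=> t IHt; rewrite -lpa_oppE -[X in P X](scaleN1r (lpa_class t)).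
  exact: PZ.
- by move=> t IHt u IHu; rewrite -lpa_addE; apply: PD.
- by move=> k t IHt; rewrite -lpa_scaleE; apply: PZ.
- by move=> t IHt u IHu; rewrite -lpa_mulE; apply: PM.
Qed.

Lemma lpaVV v : lpaV v ** lpaV v = lpaV v.
Proof. by rewrite /rmul /= lpa_mulE; apply/lpa_classP/lcong_idem. Qed.

Lemma lpaV_orth v w : v != w -> lpaV v ** lpaV w = 0.
Proof.
by move=> /eqP vw; rewrite /rmul /= lpa_mulE; apply/lpa_classP/lcong_orth.
Qed.

Lemma lpaVE f : lpaV (src f) ** lpaE f = lpaE f.
Proof. by rewrite /rmul /= lpa_mulE; apply/lpa_classP/lcong_src_edge. Qed.

Lemma lpaEV f : lpaE f ** lpaV (rng f) = lpaE f.
Proof. by rewrite /rmul /= lpa_mulE; apply/lpa_classP/lcong_edge_rng. Qed.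

Lemma lpaVG f : lpaV (rng f) ** lpaG f = lpaG f.
Proof. by rewrite /rmul /= lpa_mulE; apply/lpa_classP/lcong_rng_ghost. Qed.

Lemma lpaGV f : lpaG f ** lpaV (src f) = lpaG f.
Proof. by rewrite /rmul /= lpa_mulE; apply/lpa_classP/lcong_ghost_src. Qed.

Lemma lpaGE f g : lpaG f ** lpaE g = if f == g then lpaV (rng f) else 0.
Proof.
rewrite /rmul /= lpa_mulE; case: eqP => [->|fg]; apply/lpa_classP.
- exact: lcong_CK1_eq.
- exact: lcong_CK1_neq.
Qed.

Lemma lpaV_CK2 v (fs : seq (edge E)) :
  uniq fs -> (forall f, f \in fs <-> src f = v) -> fs <> [::] ->
  lpaV v = \sum_(f <- fs) lpaE f ** lpaG f.
Proof.
move=> ufs fsP fs0.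
transitivity (lpa_class (lsum [seq LMul (LEdge K f) (LGhost K f) | f <- fs])).
  exact/lpa_classP/lcong_CK2.
elim: fs {ufs fsP fs0} => [|f fs IH]; first by rewrite big_nil.
by rewrite big_cons -IH /= -lpa_addE -lpa_mulE.
Qed.

Fixpoint lterm_star (t : lterm K E) : lterm K E :=
  match t with
  | LVertex v => LVertex K v
  | LEdge f => LGhost K f
  | LGhost f => LEdge K f
  | LZero => LZero K E
  | LOpp x => LOpp (lterm_star x)
  | LAdd x y => LAdd (lterm_star x) (lterm_star y)
  | LScale k x => LScale k (lterm_star x)
  | LMul x y => LMul (lterm_star y) (lterm_star x)
  end.

Lemma lterm_starK : involutive lterm_star.
Proof. by elim=> //= [x ->|x -> y ->|k x ->|x -> y ->]. Qed.

(** The source and range relations of edges are exchanged with those of ghost edges; the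
    Cuntz-Krieger relations are self-dual. *)
Lemma lcong_star x y : lcong x y -> lcong (lterm_star x) (lterm_star y).
Proof.
elim=> {x y} /=; try by move=> *; econstructor; eauto.
- by move=> x y z *; apply/lcong_sym/lcong_mulA.
- move=> v fs ufs fsP fs0.
  have -> : lterm_star (lsum [seq LMul (LEdge K f) (LGhost K f) | f <- fs]) =
      lsum [seq LMul (LEdge K f) (LGhost K f) | f <- fs].
    by elim: fs {ufs fsP fs0} => //= f fs ->.
  exact: lcong_CK2.
Qed.

Definition lpa_star (x : L) : L := lpa_class (lterm_star (lpa_repr x)).

Lemma lpa_star_class t : lpa_star (lpa_class t) = lpa_class (lterm_star t).
Proof. by apply/lpa_classP/lcong_star/lpa_repr_class. Qed.

Lemma lpa_starK : involutive lpa_star.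
Proof. by elim/lpa_ind=> t; rewrite !lpa_star_class lterm_starK. Qed.

Lemma lpa_starD x y : lpa_star (x + y) = lpa_star x + lpa_star y.
Proof.
elim/lpa_ind: x => x; elim/lpa_ind: y => y.
by rewrite /GRing.add /= !(lpa_star_class, lpa_addE).
Qed.

Lemma lpa_starB x y : lpa_star (x - y) = lpa_star x - lpa_star y.
Proof.
elim/lpa_ind: x => x; elim/lpa_ind: y => y.
rewrite /GRing.opp /= /GRing.add /=.
by rewrite !(lpa_star_class, lpa_oppE, lpa_addE).
Qed.

Lemma lpa_starM x y : lpa_star (x ** y) = lpa_star y ** lpa_star x.
Proof.
elim/lpa_ind: x => x; elim/lpa_ind: y => y.
by rewrite /rmul /= !(lpa_star_class, lpa_mulE).
Qed.

Lemma lpa_star0 : lpa_star 0 = 0.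
Proof. exact: lpa_star_class. Qed.

Lemma lpa_star_V v : lpa_star (lpaV v) = lpaV v.
Proof. exact: lpa_star_class. Qed.

Lemma lpa_star_E f : lpa_star (lpaE f) = lpaG f.
Proof. exact: lpa_star_class. Qed.

(** Preimages under the involution turn chains of left ideals into chains of right ideals, and
    conversely. *)
Lemma lpa_left_right_artinian : left_artinian L <-> right_artinian L.
Proof.
have step (P Q : set L -> Prop) :
    (forall I, P I -> Q (lpa_star @^-1` I)) ->
    descending_chain_condition Q -> descending_chain_condition P.
  move=> PQ dccQ I PI decI.
  have [||N IN] := dccQ (fun n => lpa_star @^-1` I n).
  - by move=> n; apply: PQ.
  - by move=> n x; apply: decI.
  exists N => n Nn; have := IN n Nn; rewrite !predeqE => IE x.
  by have := IE (lpa_star x); rewrite /= lpa_starK.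
split; apply: step => I [[I0 IB] IM]; split.
- split=> [|x y /= Ix Iy]; first by rewrite /= lpa_star0.
  by rewrite lpa_starB; apply: IB.
- by move=> r x /= Ix; rewrite lpa_starM; apply: IM.
- split=> [|x y /= Ix Iy]; first by rewrite /= lpa_star0.
  by rewrite lpa_starB; apply: IB.
- by move=> r x /= Ix; rewrite lpa_starM; apply: IM.
Qed.

End Generators.

(** * Power series and the module of a branching system *)

Section PowerSeriesTwist.
Variable K : fieldType.
Implicit Type s : nat -> K.

(* Sequences [s] stand for the power series [\sum s_k T^k]: [seqX] multiplies by
   [T], [seq1X] by the unit [1 - T], and [seq1X_inv] by its inverse. *)
Definition seqX s : nat -> K := fun k => if k is j.+1 then s j else 0.
Definition seq1X s : nat -> K := fun k => s k - seqX s k.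
Definition seq1X_inv s : nat -> K := fun k => \sum_(j < k.+1) s j.

Lemma seq1XK : cancel seq1X seq1X_inv.
Proof.
move=> s; apply/funext; rewrite /seq1X_inv /seq1X.
elim=> [|k IHk]; rewrite big_ord_recr /=; first by rewrite big_ord0 add0r subr0.
by rewrite IHk addrC subrK.
Qed.

Lemma seq1X_invK : cancel seq1X_inv seq1X.
Proof.
move=> s; apply/funext; rewrite /seq1X_inv /seq1X; case=> [|k] /=.
  by rewrite big_ord_recr big_ord0 /= subr0 add0r.
by rewrite [X in X - _]big_ord_recr /= addrAC subrr add0r.
Qed.

End PowerSeriesTwist.

(* A branching system on [vertex E * nat]: [(n : nat) |-> (src f, br_enc f n)]
   embeds the fibre over [rng f] into the fibre over [src f].  The images, given
   by [br_own], are disjoint for distinct edges, and they cover the fibre over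
   every vertex that emits an edge; this yields (3) and (4). *)
Record branching (E : digraph) := Branching {
  br_own : edge E -> nat -> bool;
  br_dec : edge E -> nat -> nat;
  br_enc : edge E -> nat -> nat;
  br_ownP : forall f n, exists f', src f' = src f /\ br_own f' n;
  br_own_inj : forall f f' n,
    src f = src f' -> br_own f n -> br_own f' n -> f = f';
  br_own_enc : forall f n, br_own f (br_enc f n);
  br_decK : forall f n, br_own f n -> br_enc f (br_dec f n) = n;
  br_encK : forall f n, br_dec f (br_enc f n) = n;
}.

Section BranchingModule.
Variables (K : fieldType) (E : digraph).
Variable B : branching E.
Local Notation own := (br_own B).
Local Notation dec := (br_dec B).
Local Notation enc := (br_enc B).
Variable twisted : pred (edge E).

(** Functions on [vertex E * nat] with values in [K[[T]]]; the last argument is the index of the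
    coefficient. *)
Definition bmod := vertex E -> nat -> nat -> K.

Lemma bmod_ext (phi psi : bmod) :
  (forall x n k, phi x n k = psi x n k) -> phi = psi.
Proof. by move=> eq; do 3!apply/funext => ?. Qed.

Definition bmod_tw f (s : nat -> K) := if twisted f then seq1X s else s.
Definition bmod_tw_inv f (s : nat -> K) := if twisted f then seq1X_inv s else s.

Lemma bmod_twK f : cancel (bmod_tw f) (bmod_tw_inv f).
Proof.
move=> s; rewrite /bmod_tw /bmod_tw_inv.
by case: (twisted f) => //; rewrite seq1XK.
Qed.

Lemma bmod_tw_invK f : cancel (bmod_tw_inv f) (bmod_tw f).
Proof.
move=> s; rewrite /bmod_tw /bmod_tw_inv.
by case: (twisted f) => //; rewrite seq1X_invK.
Qed.

Lemma bmod_twD f s s' k :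
  bmod_tw f (fun j => s j + s' j) k = bmod_tw f s k + bmod_tw f s' k.
Proof.
rewrite /bmod_tw; case: (twisted f) => //; rewrite /seq1X.
by case: k => [|k] /=; rewrite ?subr0 // opprD addrACA.
Qed.

Lemma bmod_twZ f a s k : bmod_tw f (fun j => a * s j) k = a * bmod_tw f s k.
Proof.
rewrite /bmod_tw; case: (twisted f) => //; rewrite /seq1X.
by case: k => [|k] /=; rewrite ?subr0 // mulrBr.
Qed.

Lemma bmod_tw_invD f s s' k :
  bmod_tw_inv f (fun j => s j + s' j) k =
  bmod_tw_inv f s k + bmod_tw_inv f s' k.
Proof.
by rewrite /bmod_tw_inv; case: (twisted f) => //; rewrite /seq1X_inv big_split.
Qed.

Lemma bmod_tw_invZ f a s k :
  bmod_tw_inv f (fun j => a * s j) k = a * bmod_tw_inv f s k.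
Proof.
by rewrite /bmod_tw_inv; case: (twisted f) => //; rewrite /seq1X_inv mulr_sumr.
Qed.

(* [(f phi)(f p) = phi p] and [(f^* phi)(p) = phi (f p)], up to the twist by
   [1 - T] of the edges in [twisted]. *)
Definition actV v (phi : bmod) : bmod := fun x n k =>
  if x == v then phi x n k else 0.

Definition actE f (phi : bmod) : bmod := fun x n k =>
  if (x == src f) && own f n then bmod_tw f (phi (rng f) (dec f n)) k else 0.

Definition actG f (phi : bmod) : bmod := fun x n k =>
  if x == rng f then bmod_tw_inv f (phi (src f) (enc f n)) k else 0.

Fixpoint act_term (t : lterm K E) (phi : bmod) : bmod :=
  match t with
  | LVertex v => actV v phi
  | LEdge f => actE f phi
  | LGhost f => actG f phi
  | LZero => fun _ _ _ => 0
  | LOpp t => fun x n k => - act_term t phi x n k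
  | LAdd t u => fun x n k => act_term t phi x n k + act_term u phi x n k
  | LScale a t => fun x n k => a * act_term t phi x n k
  | LMul t u => act_term t (act_term u phi)
  end.

Definition bmodD (phi psi : bmod) : bmod := fun x n k => phi x n k + psi x n k.
Definition bmodZ a (phi : bmod) : bmod := fun x n k => a * phi x n k.

(** Additivity is what [lcong_mulDr] demands of the action, just as [lcong_scaleAr] demands
    [act_termZ]. *)
Lemma act_termD t phi psi :
  act_term t (bmodD phi psi) = bmodD (act_term t phi) (act_term t psi).
Proof.
elim: t phi psi => [v|f|f||t IHt|t IHt u IHu|a t IHt|t IHt u IHu] phi psi /=;
  rewrite ?IHu ?IHt //; apply: bmod_ext => x n k;
  rewrite /bmodD ?addr0 ?opprD ?mulrDr //.
- by rewrite /actV; case: ifP; rewrite ?addr0.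
- by rewrite /actE bmod_twD; case: ifP; rewrite ?addr0.
- by rewrite /actG bmod_tw_invD; case: ifP; rewrite ?addr0.
- exact: addrACA.
Qed.

Lemma act_termZ t a phi : act_term t (bmodZ a phi) = bmodZ a (act_term t phi).
Proof.
elim: t phi => [v|f|f||t IHt|t IHt u IHu|b t IHt|t IHt u IHu] phi /=;
  rewrite ?IHu ?IHt //; apply: bmod_ext => x n k;
  rewrite /bmodZ ?mulr0 ?mulrN ?mulrDr //.
- by rewrite /actV; case: ifP; rewrite ?mulr0.
- by rewrite /actE bmod_twZ; case: ifP; rewrite ?mulr0.
- by rewrite /actG bmod_tw_invZ; case: ifP; rewrite ?mulr0.
- exact: mulrCA.
Qed.

(** The twists cancel, so [f f^*] is the projection onto the points owned by [f]. *)
Lemma actE_actG f phi x n k : actE f (actG f phi) x n k =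
  if (x == src f) && own f n then phi x n k else 0.
Proof.
rewrite /actE /actG; case: ifP => // /andP[/eqP -> ownf].
transitivity (bmod_tw f (bmod_tw_inv f (phi (src f) n)) k); last first.
  by rewrite bmod_tw_invK.
by congr (bmod_tw f _ k); apply/funext => j; rewrite eqxx br_decK.
Qed.

(** This lets the action descend to the quotient. The algebra axioms hold pointwise or by linearity,
    the Cuntz-Krieger relations by the axioms of a branching system. *)
Lemma act_term_lcong t u : lcong t u -> act_term t = act_term u.
Proof.
move=> tu; apply/funext => phi; move: phi; elim: tu => {t u} //=.
- by move=> x y z _ xy _ yz phi; rewrite xy.
- by move=> x y _ xy phi; rewrite xy.
- by move=> x x' y y' _ xx' _ yy' phi; rewrite xx' yy'.
- by move=> a x x' _ xx' phi; rewrite xx'.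
- by move=> x x' y y' _ xx' _ yy' phi; rewrite yy' xx'.
- by move=> *; apply: bmod_ext => x n k; rewrite addrA.
- by move=> *; apply: bmod_ext => x n k; rewrite addrC.
- by move=> *; apply: bmod_ext => x n k; rewrite add0r.
- by move=> *; apply: bmod_ext => x n k; rewrite addNr.
- by move=> *; apply: bmod_ext => x n k; rewrite mulrA.
- by move=> *; apply: bmod_ext => x n k; rewrite mul1r.
- by move=> *; apply: bmod_ext => x n k; rewrite mulrDr.
- by move=> *; apply: bmod_ext => x n k; rewrite mulrDl.
- by move=> x y z phi; exact: act_termD.
- by move=> a x y phi; rewrite [RHS]act_termZ.
- move=> v phi; apply: bmod_ext => x n k.
  by rewrite /actV; case: (x == v).
- move=> v w vw phi; apply: bmod_ext => x n k.
  by rewrite /actV; case: eqP => // ->; case: eqP.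
- move=> f phi; apply: bmod_ext => x n k.
  by rewrite /actV /actE; case: eqP.
- move=> f phi; apply: bmod_ext => x n k.
  by rewrite /actV /actE eqxx.
- move=> f phi; apply: bmod_ext => x n k.
  by rewrite /actV /actG; case: eqP.
- move=> f phi; apply: bmod_ext => x n k.
  by rewrite /actV /actG eqxx.
- move=> f phi; apply: bmod_ext => x n k.
  rewrite /actV /actG; case: eqP => // ->.
  transitivity (bmod_tw_inv f (bmod_tw f (phi (rng f) n)) k); last first.
    by rewrite bmod_twK.
  congr (bmod_tw_inv f _ k); apply/funext => j.
  by rewrite /actE br_own_enc br_encK !eqxx.
- move=> f f' ff' phi; apply: bmod_ext => x n k.
  rewrite /actG; case: eqP => // _.
  (* Zero is written [0 * 0] so that homogeneity of the inverse twist applies. *)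
  transitivity (bmod_tw_inv f (fun=> 0 * 0) k); last first.
    by rewrite bmod_tw_invZ mul0r.
  congr (bmod_tw_inv f _ k); apply/funext => j; rewrite /actE mul0r.
  case: ifP => // /andP[/eqP sff' ownf'].
  by case: ff'; apply: br_own_inj sff' _ ownf'; apply: br_own_enc.
- move=> v fs ufs fsP fs0 phi.
  apply: bmod_ext => x n k.
  have -> : act_term (lsum [seq LMul (LEdge K f) (LGhost K f) | f <- fs])
      phi x n k = \sum_(f <- fs) actE f (actG f phi) x n k.
    elim: fs {ufs fsP fs0} => [|f fs IH]; first by rewrite big_nil.
    by rewrite big_cons -IH.
  (* Each point over [v] is owned by exactly one edge leaving [v], so a single summand survives. *)
  under eq_bigr => f _ do rewrite actE_actG.
  have srcfs f : f \in fs -> src f = v by move/fsP.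
  have [f0 /srcfs vf0] : exists f, f \in fs.
    by case: fs fs0 {ufs fsP srcfs} => // f fs _; exists f; rewrite mem_head.
  rewrite /actV; case: (eqVneq x v) => [->|xv]; last first.
    by rewrite big_seq big1 // => f /srcfs ->; rewrite (negbTE xv).
  have [f1 []] := br_ownP B f0 n; rewrite vf0 => vf1 own1.
  have f1fs : f1 \in fs by apply/fsP.
  rewrite (bigD1_seq _ f1fs ufs) /= vf1 eqxx own1 big1_seq ?addr0 // => f.
  move=> /andP[ff1 /srcfs vf]; case: ifP => // /andP[_ ownf].
  by case/eqP: ff1; apply: br_own_inj ownf own1; rewrite vf.
Qed.

Definition act (a : LPA K E) : bmod -> bmod := act_term (lpa_repr a).

Lemma act_class t : act (lpa_class t) = act_term t.
Proof. exact/act_term_lcong/lpa_repr_class. Qed.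

Lemma actM a b phi : act (a ** b) phi = act a (act b phi).
Proof.
elim/lpa_ind: a => t; elim/lpa_ind: b => u.
by rewrite /rmul /= lpa_mulE !act_class.
Qed.

Lemma actB a b phi x n k :
  act (a - b) phi x n k = act a phi x n k - act b phi x n k.
Proof.
elim/lpa_ind: a => t; elim/lpa_ind: b => u.
by rewrite /GRing.opp /= /GRing.add /= lpa_oppE lpa_addE !act_class.
Qed.

Lemma act0 phi x n k : act 0 phi x n k = 0.
Proof. by rewrite act_class. Qed.

Lemma act_lpaV v phi : act (lpaV K v) phi = actV v phi.
Proof. by rewrite act_class. Qed.

Lemma act_lpaE f phi : act (lpaE K f) phi = actE f phi.
Proof. by rewrite act_class. Qed.

End BranchingModule.

(** * Existence of branching systems *)

Lemma uniq_map_inj_in (T U : eqType) (f : T -> U) (s : seq T) :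
  uniq (map f s) -> {in s &, injective f}.
Proof.
elim: s => //= a s IHs /andP[fas us] x y; rewrite !inE.
move=> /predU1P[->|xs] /predU1P[->|ys] // fxy; last exact: IHs.
- by rewrite fxy map_f in fas.
- by rewrite -fxy map_f in fas.
Qed.

(** The pairs [(f, n)] with [f] leaving [src p] form a countable set, infinite because it contains
    every [(p, n)]. *)
Lemma fiber_enumeration (E : digraph) (p : edge E) :
  exists (g : nat -> edge E * nat) (h : edge E * nat -> nat),
  [/\ forall n, src (g n).1 = src p, cancel g h,
      forall q, src q.1 = src p -> g (h q) = q & g 0 = (p, 0)].
Proof.
pose A := [set q : edge E * nat | src q.1 = src p].
have infA : ~ finite_set A.
  apply/infiniteP.
  have /injfunPex[f] : exists2 f : nat -> edge E * nat,
      set_fun [set: nat] A f & set_inj [set: nat] f.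
    by exists (pair p) => // m n _ _ [].
  exact: inj_card_le f.
have /card_set_bijP[b [_ binj bsurj]] := eq_card_nat (countableP A) infA.
have /choice[g gP] : forall n, exists q, A q /\ b q = n.
  by move=> n; have [q Aq bq] := bsurj n I; exists q.
(* The transposition of [0] and [b (p, 0)] puts [(p, 0)] in front. *)
pose m := b (p, 0).
pose s n := if n == 0 then m else if n == m then 0 else n.
have sK : involutive s.
  move=> n; rewrite /s; case: (eqVneq n 0) => [->|n0].
    by case: (eqVneq m 0) => // _; rewrite eqxx.
  by case: (eqVneq n m) => [->|nm]; rewrite ?eqxx // (negbTE n0) (negbTE nm).
have gb q : A q -> g (b q) = q.
  by move=> Aq; have [Ag bg] := gP (b q); apply: binj; rewrite ?inE.
exists (g \o s), (s \o b); split=> [n|n|q Aq|] /=.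
- by have [] := gP (s n).
- by have [_ ->] := gP (s n).
- by rewrite sK gb.
- by rewrite /s eqxx gb.
Qed.

(** At most one edge of [C] leaves each vertex, and its pair [(f, 0)] can be enumerated first. If
    [C] is a cycle, the point 0 over its vertices thus stands for the infinite path going round
    it. *)
Lemma branching_exists (E : digraph) (C : seq (edge E)) :
  uniq (map (@src E) C) ->
  exists B : branching E, forall f, f \in C -> br_enc B f 0 = 0.
Proof.
move=> uC.
(* [ok v t] restricts the axioms to the edges leaving [v], so that the data can be chosen vertex by
   vertex. *)
pose ok (v : vertex E) (t : (edge E -> nat -> bool) * (edge E -> nat -> nat) *
    (edge E -> nat -> nat)) := let: (own, dec, enc) := t in
  [/\ forall f n, src f = v -> exists f', src f' = v /\ own f' n,
      forall f f' n, src f = v -> src f' = v -> own f n -> own f' n -> f = f',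
      forall f n, src f = v -> own f (enc f n),
      forall f n, src f = v -> own f n -> enc f (dec f n) = n &
      forall f n, src f = v -> dec f (enc f n) = n] /\
  forall f, f \in C -> src f = v -> enc f 0 = 0.
have /choice[t tP] v : exists t, ok v t.
  have [[p0 p0v]|novP] := pselect (exists p, src p = v); last first.
    (* Dummy data at a vertex emitting no edge, where every condition is vacuous. *)
    exists (fun _ _ => false, fun _ _ => 0, fun _ _ => 0).
    by split; [split|] => f *; case: novP; exists f.
  have [p pv pC] : exists2 p, src p = v &
      forall f, f \in C -> src f = v -> f = p.
    have [[p [pC pv]]|noC] := pselect (exists p, p \in C /\ src p = v).
      by exists p => // f fC fv; apply: (uniq_map_inj_in uC) => //; rewrite pv.
    by exists p0 => // f fC fv; case: noC; exists f.
  have [g [h [gsrc gK hK g0]]] := fiber_enumeration p.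
  (* The owner of [n] is the first component of [g n]; the second one is the decoded point. *)
  exists (fun f n => (g n).1 == f, fun f n => (g n).2, fun f n => h (f, n)).
  rewrite -pv; split; [split|] => f n.
  - by move=> _; exists (g n).1.
  - by move=> k _ _ /eqP <- /eqP.
  - by move=> fv; rewrite hK.
  - by move=> fv /eqP <-; rewrite -surjective_pairing gK.
  - by move=> fv; rewrite hK.
  - by move=> fv; rewrite (pC f) ?fv // -g0 gK.
pose own f := (t (src f)).1.1 f.
pose dec f := (t (src f)).1.2 f.
pose enc f := (t (src f)).2 f.
have okP f : ok (src f) (t (src f)) by [].
unshelve eexists (@Branching E own dec enc _ _ _ _ _).
- move=> f n; rewrite /own.
  suff [f' [f'v of']] : exists f', src f' = src f /\ (t (src f)).1.1 f' n.
    by exists f'; rewrite f'v.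
  by have := okP f; case: (t _) => -[o d] e [[+ _ _ _ _] _]; apply.
- move=> f f' n ff'; rewrite /own -ff'; have := okP f.
  by case: (t _) => -[o d] e [[_ + _ _ _] _]; apply; rewrite ?ff'.
- move=> f n; have := okP f; rewrite /own /enc.
  by case: (t _) => -[o d] e [[_ _ + _ _] _]; apply.
- move=> f n; have := okP f; rewrite /own /enc /dec.
  by case: (t _) => -[o d] e [[_ _ _ + _] _]; apply.
- move=> f n; have := okP f; rewrite /own /enc /dec.
  by case: (t _) => -[o d] e [[_ _ _ _ +] _]; apply.
- move=> f fC /=; have := okP f; rewrite /own /enc /dec.
  by case: (t _) => -[o d] e [_ +]; apply.
Qed.

(** * Finiteness and acyclicity of the graph of a right artinian algebra *)

Lemma infinite_injection (T : choiceType) :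
  ~ finite_set [set: T] -> exists f : nat -> T, injective f.
Proof.
move=> infT; have [x0 _] := infinite_setN0 infT.
pose T' : pointedType := HB.pack T (isPointed.Build T x0).
have /pcard_leTP/injPex[f finj] : ([set: nat] #<= [set: T'])%card.
  exact/infiniteP.
by exists f => m n /finj; apply; rewrite inE.
Qed.

Section NotArtinian.
Variables (K : fieldType) (E : digraph).

(** A vertex fixes the values over itself, so it does not kill the constant function 1. *)
Lemma lpaV_neq0 (v : vertex E) : lpaV K v <> 0.
Proof.
move=> v0; have [B _] := @branching_exists E [::] isT.
have : act B pred0 (lpaV K v) (fun _ _ _ => 1) v 0 0 = 0 by rewrite v0 act0.
by rewrite act_lpaV /actV eqxx => /eqP; rewrite oner_eq0.
Qed.

Lemma right_artinian_finite_graph : right_artinian (LPA K E) -> finite_graph E.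
Proof.
move=> art; split; apply: contrapT => /infinite_injection[f finj].
- refine (@right_artinian_triangular (LPA K E)
    (@lpaV K E \o f) (@lpaV K E \o f) _ _ art) => [k n kn|n] /=.
    by rewrite lpaV_orth // (inj_eq finj) ltn_eqF.
  by rewrite lpaVV; apply: lpaV_neq0.
- refine (@right_artinian_triangular (LPA K E)
    (@lpaG K E \o f) (@lpaE K E \o f) _ _ art) => [k n kn|n] /=.
    by rewrite lpaGE (inj_eq finj) ltn_eqF.
  by rewrite lpaGE eqxx; apply: lpaV_neq0.
Qed.

(** The range [w] is passed separately so that the empty path is the vertex [w]. *)
Definition lpa_path (mu : seq (edge E)) (w : vertex E) : LPA K E :=
  foldr (fun f x => lpaE K f ** x) (lpaV K w) mu.

Lemma act_lpaE0 (B : branching E) tw f x phi :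
  br_enc B f 0 = 0 ->
  act B tw (lpaE K f ** x) phi (src f) 0 =1
  bmod_tw tw f (act B tw x phi (rng f) 0).
Proof.
move=> f0 k; rewrite actM act_lpaE /actE eqxx.
by rewrite -[X in br_own B f X]f0 br_own_enc -[X in br_dec B f X]f0 br_encK.
Qed.

Lemma act_untwisted_path (B : branching E) (tw : pred (edge E)) f mu phi :
  path (fun f g => rng f == src g) f mu ->
  {in mu, forall g, br_enc B g 0 = 0 /\ ~~ tw g} ->
  act B tw (lpa_path mu (rng (last f mu))) phi (rng f) 0 =1
  phi (rng (last f mu)) 0.
Proof.
elim: mu f => [|g mu IHmu] f /=; first by rewrite act_lpaV /actV eqxx.
move=> /andP[/eqP -> gmu] mu0 k.
have [g0 ntw] := mu0 _ (mem_head _ _).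
rewrite act_lpaE0 // /bmod_tw (negbTE ntw) IHmu // => h hmu.
by apply: mu0; rewrite inE hmu orbT.
Qed.

Lemma iter_seqX_lt n (s : nat -> K) k : (k < n)%N -> iter n (@seqX K) s k = 0.
Proof. by elim: n k => // n IHn [|k] //= kn; apply: IHn. Qed.

Lemma iter_seqX_add n (s : nat -> K) k : iter n (@seqX K) s (n + k) = s k.
Proof. by elim: n => //= n IHn; rewrite addSn. Qed.

Lemma right_artinian_acyclic : right_artinian (LPA K E) -> acyclic E.
Proof.
move=> art [//|e p]; apply/negP => /and3P[/= path_p /eqP closed_p uniq_p].
have [B B0] := @branching_exists E (e :: p) uniq_p.
pose v := src e; pose c := lpa_path (e :: p) v; pose t := lpaV K v - c.
have [N /(_ (lpaV K v))[y ty]] := right_artinian_powers t art.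
(* Only [e] is twisted, and distinct sources keep it from recurring in [p], so one turn round the
   cycle multiplies by [1 - T] once. *)
have actc phi : act B (pred1 e) c phi v 0 =1 seq1X (phi v 0).
  move=> k; rewrite /c /= act_lpaE0 ?B0 ?mem_head // /bmod_tw /= eqxx.
  congr (seq1X _ k); apply/funext => j; rewrite /v closed_p.
  apply: act_untwisted_path => // g gp; split.
    by rewrite B0 // inE gp orbT.
  by apply/eqP => ge; rewrite -ge map_f in uniq_p.
(* At this point [t] acts as [1 - (1 - T) = T]. *)
have actt phi : act B (pred1 e) t phi v 0 = seqX (phi v 0).
  apply/funext => k; rewrite actB act_lpaV /actV eqxx actc /seq1X.
  by rewrite opprB addrC subrK.
have actiter n x phi : act B (pred1 e) (iter n (rmul t) x) phi v 0 =
    iter n (@seqX K) (act B (pred1 e) x phi v 0).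
  by elim: n => //= n IHn; rewrite actM actt IHn.
pose phi : bmod K E := fun _ _ k => (k == 0)%:R.
(* The coefficient of [T^N] is 1 on the left and 0 on the right, which is a multiple of
   [T^(N+1)]. *)
have := congr1 (fun x => act B (pred1 e) x phi v 0 (N + 0)%N) ty.
rewrite !actiter iter_seqX_add [RHS]iter_seqX_lt ?addn0 //.
by rewrite act_lpaV /actV eqxx => /eqP; rewrite oner_eq0.
Qed.

End NotArtinian.

(** * Paths to sinks and the expansion of vertices *)

Section Paths.
Variables (K : fieldType) (E : digraph).
Implicit Types (mu nu : seq (edge E)) (v w : vertex E).

Definition sink w := forall f : edge E, src f != w.

Definition path_src mu w := if mu is f :: _ then src f else w.

(** The last edge is compared with [path_src [::] w], which is [w]; hence [mu] is a path with range
    [w], possibly empty. *)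
Fixpoint path_to mu w :=
  if mu is f :: mu' then (rng f == path_src mu' w) && path_to mu' w else true.

Lemma lpaV_path v mu w :
  lpaV K v ** lpa_path K mu w =
  if v == path_src mu w then lpa_path K mu w else 0.
Proof.
case: mu => [|f mu] /=; case: (eqVneq v) => [->|vw].
- by rewrite lpaVV.
- by rewrite lpaV_orth.
- by rewrite rmulA lpaVE.
- by rewrite -lpaVE !rmulA lpaV_orth // !rmul0r.
Qed.

Lemma lpaE_path f mu w : path_to mu w ->
  lpaE K f ** lpa_path K mu w =
  if rng f == path_src mu w then lpa_path K (f :: mu) w else 0.
Proof.
move=> muw; rewrite -lpaEV -rmulA lpaV_path.
by case: ifP; rewrite ?rmulr0 // rmulA lpaEV.
Qed.

(** Equal first edges cancel and distinct ones give 0. A path exhausted before the other ends at a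
    sink, which is not the source of the other's next edge. *)
Lemma star_lpa_pathM mu nu w w' :
  sink w -> sink w' -> path_to mu w -> path_to nu w' ->
  lpa_star (lpa_path K mu w) ** lpa_path K nu w' =
  if (mu, w) == (nu, w') then lpaV K w else 0.
Proof.
move=> sw sw'; elim: mu nu => [|f mu IHmu] [|g nu] //=.
- move=> _ _; rewrite lpa_star_V xpair_eqE eqxx /=.
  by case: eqVneq => [->|ww']; [rewrite lpaVV | rewrite lpaV_orth].
- by move=> _ _; rewrite lpa_star_V -lpaVE !rmulA lpaV_orth 1?eq_sym // !rmul0r.
- move=> _ _; rewrite lpa_starM lpa_star_E -lpaGV -!rmulA lpaV_orth //.
  by rewrite !rmulr0.
- move=> /andP[/eqP fmu muw] /andP[/eqP gnu nuw'].
  rewrite lpa_starM lpa_star_E rmulA -[_ ** lpaG K f ** lpaE K g]rmulA lpaGE.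
  rewrite xpair_eqE eqseq_cons; case: (eqVneq f g) => [fg|_]; last first.
    by rewrite rmulr0 rmul0r.
  by rewrite -rmulA lpaV_path fg gnu eqxx IHmu // xpair_eqE.
Qed.

Lemma path_to_path f mu w :
  path_to (f :: mu) w -> path (fun f g => rng f == src g) f mu.
Proof. by elim: mu f => //= g mu IHmu f /andP[-> /IHmu]. Qed.

(** If [f] shares its source with a later edge [g], the segment from [f] to just before [g] is a
    cycle, its sources being distinct by induction. *)
Lemma acyclic_path_uniq mu w :
  acyclic E -> path_to mu w -> uniq (map (@src E) mu).
Proof.
move=> acE; elim: mu => //= f mu IHmu /andP[fmu muw]; rewrite IHmu // andbT.
apply/negP => /mapP[g gmu fg]; have umu := IHmu muw.
have : path (fun f g => rng f == src g) f mu.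
  by apply: (@path_to_path _ _ w); rewrite /= fmu.
case/splitPr: gmu umu => mu1 mu2; rewrite cat_path /= => umu /and3P[pmu1 lg _].
have /negP := acE (f :: mu1); apply; rewrite /= pmu1 fg eq_sym lg /=.
move: umu; rewrite map_cat cat_uniq /= negb_or => /and3P[-> /andP[g1 _] _].
by rewrite g1.
Qed.

Variables (vs : seq (vertex E)) (es : seq (edge E)).
Hypothesis uvs : uniq vs.
Hypothesis ues : uniq es.
Hypothesis mem_vs : forall v, v \in vs.
Hypothesis mem_es : forall f, f \in es.

Definition out v := [seq f <- es | src f == v].

Lemma mem_out f v : (f \in out v) = (src f == v).
Proof. by rewrite mem_filter mem_es andbT. Qed.

Lemma out_sink w : out w = [::] -> sink w.
Proof. by move=> w0 f; rewrite -mem_out w0. Qed.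

(* Paths starting at [v] that either end at a sink or have length [n]. *)
Fixpoint paths_from n v : seq (seq (edge E) * vertex E) :=
  if n is m.+1 then
    if out v is [::] then [:: ([::], v)] else
    [seq (f :: a.1, a.2) | f <- out v, a <- paths_from m (rng f)]
  else [:: ([::], v)].

Lemma paths_fromP n v a : a \in paths_from n v ->
  [/\ path_src a.1 a.2 = v, path_to a.1 a.2 & sink a.2 \/ size a.1 = n].
Proof.
elim: n v a => [|n IHn] v a /=.
  by rewrite inE => /eqP ->; split=> //; right.
case ov : (out v) => [|f0 fs]; last rewrite -ov.
  by rewrite inE => /eqP ->; split=> //; left; apply: out_sink.
move=> /allpairsPdep[f [b [fv /IHn[bf bp bn] ->]]] /=.
split; [by apply/eqP; rewrite -mem_out | by rewrite bf eqxx |].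
by case: bn => [|->]; [left|right].
Qed.

Lemma paths_from_uniq n v : uniq (paths_from n v).
Proof.
elim: n v => //= n IHn v; case ov : (out v) => [//|f0 fs]; rewrite -ov.
apply: allpairs_uniq_dep => [|f _|]; [exact: filter_uniq | exact: IHn |].
by move=> [f [mu w]] [g [nu w']] _ _ /= [-> -> ->].
Qed.

Definition lpa_pair (a : seq (edge E) * vertex E) := lpa_path K a.1 a.2.

(** By [lpaV_CK2], [v] is a sum of [f f^*]; the expansion of [rng f] is then inserted between [f]
    and [f^*]. *)
Lemma lpaV_paths_from n v :
  lpaV K v = \sum_(a <- paths_from n v) lpa_pair a ** lpa_star (lpa_pair a).
Proof.
elim: n v => [|n IHn] v /=.
  by rewrite big_seq1 /lpa_pair /= lpa_star_V lpaVV.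
case ov : (out v) => [|f0 fs]; last rewrite -ov.
  by rewrite big_seq1 /lpa_pair /= lpa_star_V lpaVV.
rewrite (@lpaV_CK2 K E v (out v)); last 3 first.
- exact: filter_uniq.
- by move=> f; rewrite mem_out; split=> /eqP.
- by rewrite ov.
rewrite big_allpairs_dep; apply: eq_bigr => f _ /=.
rewrite -{1}lpaEV (IHn (rng f)) -rmulA rmul_suml rmul_sumr.
apply: eq_bigr => a _; rewrite /lpa_pair /= lpa_starM lpa_star_E.
by rewrite !rmulA.
Qed.

Hypothesis acE : acyclic E.

Definition sink_paths :=
  [seq a | v <- vs, a <- paths_from (size vs).+1 v].

Definition sink_path (a : seq (edge E) * vertex E) :=
  path_to a.1 a.2 /\ sink a.2.

(** A path cut off at length [(size vs).+1] would have more distinct sources than there are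
    vertices. *)
Lemma mem_sink_paths a : a \in sink_paths -> sink_path a.
Proof.
move=> /allpairsPdep[v [b [_ /paths_fromP[_ bp bs] ->]]]; split => //.
case: bs => // sb; have := uniq_leq_size (acyclic_path_uniq acE bp).
by rewrite size_map sb => /(_ vs (fun v _ => mem_vs v)); rewrite ltnn.
Qed.

(** The starting vertex is recovered by [path_src], so the lists of different vertices are
    disjoint. *)
Lemma sink_paths_uniq : uniq sink_paths.
Proof.
apply: allpairs_uniq_dep => // [v _|]; first exact: paths_from_uniq.
have tagP p : p \in [seq existT (fun=> (seq (edge E) * vertex E)%type) v a |
    v <- vs, a <- paths_from (size vs).+1 v] ->
  tag p = path_src (tagged p).1 (tagged p).2.
  by move=> /allpairsPdep[v [a [_ /paths_fromP[va _ _] ->]]]; rewrite /= va.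
by move=> [v a] [w b] /tagP /= va /tagP /= wb ab; rewrite va wb ab.
Qed.

(** * The identity and the matrix coefficients *)

Definition lpa1 : LPA K E := \sum_(v <- vs) lpaV K v.

Lemma lpa1E : lpa1 = \sum_(a <- sink_paths) lpa_pair a ** lpa_star (lpa_pair a).
Proof.
rewrite big_allpairs_dep; apply: eq_bigr => v _.
exact: lpaV_paths_from.
Qed.

Lemma lpa1V v : lpa1 ** lpaV K v = lpaV K v.
Proof.
rewrite rmul_suml (bigD1_seq v) //= lpaVV big1 ?addr0 // => w wv.
by rewrite lpaV_orth.
Qed.

Lemma lpa1_star : lpa_star lpa1 = lpa1.
Proof.
rewrite (big_morph _ (@lpa_starD K E) (lpa_star0 K E)).
by apply: eq_bigr => v _; rewrite lpa_star_V.
Qed.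

Lemma lpa1_mul x : lpa1 ** x = x.
Proof.
elim/lpa_gen_ind: x => [v|f|f||x y IHx IHy|k x IHx|x y IHx _].
- exact: lpa1V.
- by rewrite -lpaVE rmulA lpa1V.
- by rewrite -lpaVG rmulA lpa1V.
- exact: rmulr0.
- by rewrite rmulDr IHx IHy.
- by rewrite -lpa_scaleAr IHx.
- by rewrite rmulA IHx.
Qed.

Lemma lpa_mul1 x : x ** lpa1 = x.
Proof. by rewrite -[LHS]lpa_starK lpa_starM lpa1_star lpa1_mul lpa_starK. Qed.

(** The matrix coefficient of [x] at row [a] and column [b], still as an element of the algebra. *)
Definition corner a x b : LPA K E := lpa_star (lpa_pair a) ** x ** lpa_pair b.

Lemma cornerD a x y b : corner a (x + y) b = corner a x b + corner a y b.
Proof. by rewrite /corner rmulDr rmulDl. Qed.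

Lemma cornerZ a k x b : corner a (k *: x) b = k *: corner a x b.
Proof. by rewrite /corner -lpa_scaleAr -lpa_scaleAl. Qed.

(** The identity, as the sum of all [c c^*], is inserted between [x] and [y]. *)
Lemma cornerM a x y b :
  corner a (x ** y) b = \sum_(c <- sink_paths) corner a x c ** corner c y b.
Proof.
rewrite /corner -{1}[y]lpa1_mul lpa1E rmul_suml !rmul_sumr rmul_suml.
by apply: eq_bigr => c _; rewrite !rmulA.
Qed.

Lemma corner1 a b : sink_path a -> sink_path b ->
  lpa_star (lpa_pair a) ** lpa_pair b = if a == b then lpaV K a.2 else 0.
Proof.
by case: a b => [mu w] [nu w'] [? ?] [? ?]; apply: star_lpa_pathM.
Qed.

(** Induction on [x]: a vertex or an edge times [b] is 0 or again a path to a sink, and dually for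
    [a^*] times a ghost edge. Products reduce to [cornerM]. *)
Lemma corner_scalar a x b : sink_path a -> sink_path b ->
  exists k, corner a x b = k *: (if a.2 == b.2 then lpaV K a.2 else 0).
Proof.
have delta c d : sink_path c -> sink_path d -> exists k,
    lpa_star (lpa_pair c) ** lpa_pair d =
    k *: (if c.2 == d.2 then lpaV K c.2 else 0).
  move=> gc gd; rewrite corner1 //; case: (eqVneq c d) => [->|_].
    by exists 1; rewrite eqxx scale1r.
  by exists 0; rewrite scale0r.
elim/lpa_gen_ind: x a b => [v|f|f||x y IHx IHy|k x IHx|x y IHx IHy] a b ga gb.
- rewrite /corner -rmulA lpaV_path; case: ifP => _; first exact: delta.
  by exists 0; rewrite rmulr0 scale0r.
- rewrite /corner -rmulA lpaE_path; last by case: gb.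
  case: ifP => fb; last by exists 0; rewrite rmulr0 scale0r.
  apply: (delta a (f :: b.1, b.2)) => //.
  by case: gb => *; split; rewrite //= fb.
- rewrite /corner -{1}[lpaG K f]lpa_star_E -lpa_starM lpaE_path; last first.
    by case: ga.
  case: ifP => fa; last by exists 0; rewrite lpa_star0 rmul0r scale0r.
  apply: (delta (f :: a.1, a.2) b) => //.
  by case: ga => *; split; rewrite //= fa.
- by exists 0; rewrite /corner rmulr0 rmul0r scale0r.
- have [k kP] := IHx _ _ ga gb; have [l lP] := IHy _ _ ga gb.
  by exists (k + l); rewrite cornerD kP lP scalerDl.
- have [l lP] := IHx _ _ ga gb.
  by exists (k * l); rewrite cornerZ lP scalerA.
- rewrite cornerM big_seq.
  elim/big_ind: _ => [|_ _ [k ->] [l ->]|c /mem_sink_paths gc].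
  + by exists 0; rewrite scale0r.
  + by exists (k + l); rewrite scalerDl.
  have [k ->] := IHx _ _ ga gc; have [l ->] := IHy _ _ gc gb.
  case: (eqVneq a.2 c.2) => [->|_]; last first.
    by exists 0; rewrite scaler0 rmul0r scale0r.
  case: (eqVneq c.2 b.2) => [_|_]; last first.
    by exists 0; rewrite scaler0 rmulr0 scale0r.
  by exists (k * l); rewrite -lpa_scaleAl -lpa_scaleAr scalerA lpaVV.
Qed.

Lemma corner_ranges_neq a x b :
  sink_path a -> sink_path b -> a.2 != b.2 -> corner a x b = 0.
Proof.
move=> ga gb ab; have [k ->] := corner_scalar x ga gb.
by rewrite (negbTE ab) scaler0.
Qed.

Definition lpaV_coef w (x : LPA K E) : K := xget 0 [set k | x = k *: lpaV K w].

Lemma lpaV_coefZ w k : lpaV_coef w (k *: lpaV K w) = k.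
Proof.
rewrite /lpaV_coef; case: xgetP => [l _ /= /eqP|/(_ k)[] //].
rewrite -subr_eq0 -scalerBl scaler_eq0 subr_eq0 => /orP[/eqP -> //|/eqP w0].
by case: (@lpaV_neq0 K E w).
Qed.

Lemma corner_coef a x b w : sink_path a -> sink_path b -> a.2 = w -> b.2 = w ->
  corner a x b = lpaV_coef w (corner a x b) *: lpaV K w.
Proof.
move=> ga gb aw bw; have [k] := corner_scalar x ga gb.
by rewrite aw bw eqxx => ->; rewrite lpaV_coefZ.
Qed.

(** * The isomorphism with a product of matrix algebras, one block per sink *)

Definition sinks := [seq w <- vs | out w == [::]].
Definition sink_of (i : 'I_(size sinks)) := tnth (in_tuple sinks) i.
Definition paths_to i := [seq a <- sink_paths | a.2 == sink_of i].
Definition path_at i (j : 'I_(size (paths_to i))) :=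
  tnth (in_tuple (paths_to i)) j.

Lemma path_atP i j : path_at j \in sink_paths /\ (@path_at i j).2 = sink_of i.
Proof.
have := mem_tnth j (in_tuple (paths_to i)).
by rewrite mem_filter => /andP[/eqP].
Qed.

Lemma path_at_sink_path i j : sink_path (@path_at i j).
Proof. by have [/mem_sink_paths] := path_atP j. Qed.

Lemma path_at_range i j : (@path_at i j).2 = sink_of i.
Proof. by have [] := path_atP j. Qed.

Lemma path_at_inj i : injective (@path_at i).
Proof.
move=> j l /eqP; rewrite /path_at !(tnth_nth ([::], sink_of i)) nth_uniq //.
  by move=> /eqP/val_inj.
exact/filter_uniq/sink_paths_uniq.
Qed.

Lemma path_at_surj a : a \in sink_paths -> exists i j, a = @path_at i j.
Proof.
move=> aX; have [ap sink_a] := mem_sink_paths aX.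
have : a.2 \in sinks.
  rewrite mem_filter mem_vs andbT; case oa : (out _) => [//|f s].
  by have := sink_a f; rewrite -mem_out oa mem_head.
move=> /(tnthP (in_tuple sinks)) [i ai].
have : a \in paths_to i by rewrite mem_filter aX andbT; apply/eqP.
by move=> /(tnthP (in_tuple _)) [j aj]; exists i, j.
Qed.

Definition lpa_mx x i : mxrng K (size (paths_to i)) :=
  \matrix_(j, l) lpaV_coef (sink_of i) (corner (path_at j) x (path_at l)).

Lemma lpa_mxE x i j l :
  corner (path_at j) x (path_at l) = lpa_mx x i j l *: lpaV K (sink_of i).
Proof.
by rewrite mxE; apply: corner_coef;
  do ?[exact: path_at_sink_path | exact: path_at_range].
Qed.

Lemma lpa_mx_unique x i j l k :
  corner (path_at j) x (path_at l) = k *: lpaV K (sink_of i) ->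
  lpa_mx x i j l = k.
Proof. by move=> cE; rewrite mxE cE lpaV_coefZ. Qed.

Lemma lpa_mxD x y i : lpa_mx (x + y) i = lpa_mx x i + lpa_mx y i.
Proof.
apply/matrixP => j l; rewrite [RHS]mxE; apply: lpa_mx_unique.
by rewrite cornerD !lpa_mxE scalerDl.
Qed.

Lemma lpa_mxM x y i : lpa_mx (x ** y) i = lpa_mx x i ** lpa_mx y i.
Proof.
apply/matrixP => j l; rewrite [RHS]mxE; apply: lpa_mx_unique.
rewrite cornerM (bigID (fun c => c.2 == sink_of i)) /=.
rewrite [X in _ + X]big_seq_cond [X in _ + X]big1 ?addr0; last first.
  move=> c /andP[/mem_sink_paths gc ci].
  rewrite corner_ranges_neq ?rmul0r //; first exact: path_at_sink_path.
  by rewrite path_at_range eq_sym.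
rewrite -big_filter -/(paths_to i) big_tnth scaler_suml; apply: eq_bigr => m _.
by rewrite !lpa_mxE -lpa_scaleAl -lpa_scaleAr scalerA lpaVV.
Qed.

(** Expanding the identity on both sides writes [x] as the sum of all [b (b^* x a) a^*]. Corners
    between different sinks vanish; the others are given by the entries of [lpa_mx]. *)
Lemma lpa_mx_inj x y : (forall i, lpa_mx x i = lpa_mx y i) -> x = y.
Proof.
move=> xy; rewrite -[x]lpa_mul1 -[y]lpa_mul1 -[x]lpa1_mul -[y]lpa1_mul.
rewrite lpa1E !(rmul_suml, rmul_sumr); apply: eq_big_seq => a aX.
rewrite !(rmul_suml, rmul_sumr); apply: eq_big_seq => b bX.
suff /(congr1 (fun z => lpa_pair b ** z ** lpa_star (lpa_pair a))) :
  corner b x a = corner b y a by rewrite /corner !rmulA.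
have [i [j bE]] := path_at_surj bX; have [i' [l aE]] := path_at_surj aX.
have [ii|ii] := eqVneq i i'; last first.
  have [gb ga] := (mem_sink_paths bX, mem_sink_paths aX).
  suff ba : b.2 != a.2 by rewrite !corner_ranges_neq.
  rewrite bE aE !path_at_range /sink_of !(tnth_nth (sink_of i)) /= nth_uniq //.
  exact: filter_uniq.
by subst i'; rewrite bE aE !lpa_mxE xy.
Qed.

Definition lpa_of_mx (M : forall i, mxrng K (size (paths_to i))) : LPA K E :=
  \sum_i \sum_j \sum_l
    M i j l *: (lpa_pair (path_at j) ** lpa_star (lpa_pair (path_at l))).

(** The products [a b^*] are matrix units, so taking the corner at [(j, l)] in block [i] leaves one
    term of the triple sum. *)
Lemma lpa_of_mxK M i : lpa_mx (lpa_of_mx M) i = M i.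
Proof.
apply/matrixP => j l; apply: lpa_mx_unique.
have cE a i' j' l' b : corner a
    (lpa_pair (@path_at i' j') ** lpa_star (lpa_pair (@path_at i' l'))) b =
  lpa_star (lpa_pair a) ** lpa_pair (path_at j') **
    (lpa_star (lpa_pair (path_at l')) ** lpa_pair b).
  by rewrite /corner !rmulA.
have c_sum a b (I : finType) (F : I -> LPA K E) :
    corner a (\sum_k F k) b = \sum_k corner a (F k) b.
  by rewrite /corner rmul_sumr rmul_suml.
have sink_inj i1 i2 : i1 != i2 -> sink_of i1 != sink_of i2.
  by rewrite /sink_of !(tnth_nth (sink_of i)) /= nth_uniq // filter_uniq.
have gp i1 m := @path_at_sink_path i1 m.
rewrite /lpa_of_mx c_sum (bigD1 i) //= [X in _ + X]big1 ?addr0 => [|i' ii'].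
  rewrite c_sum (bigD1 j) //= [X in _ + X]big1 ?addr0 => [|j' jj'].
    rewrite c_sum (bigD1 l) //= [X in _ + X]big1 ?addr0 => [|l' ll'].
      by rewrite cornerZ cE !corner1 // !eqxx !path_at_range lpaVV.
    rewrite cornerZ cE !corner1 // [path_at l' == _](inj_eq (@path_at_inj i)).
    by rewrite (negbTE ll') rmulr0 scaler0.
  rewrite c_sum big1 // => l' _; rewrite cornerZ cE !corner1 //.
  by rewrite (inj_eq (@path_at_inj i)) eq_sym (negbTE jj') rmul0r scaler0.
(* The paths of another block end at another sink, hence differ from [path_at j]. *)
rewrite c_sum big1 // => j' _; rewrite c_sum big1 // => l' _.
rewrite cornerZ cE corner1 //; case: eqP => [jj'|_]; last first.
  by rewrite rmul0r scaler0.
by have := sink_inj _ _ ii';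
  rewrite -(path_at_range j') -(path_at_range j) jj' eqxx.
Qed.

Lemma finite_acyclic_semisimple : semisimple (LPA K E).
Proof.
exists (size sinks), (fun i => mxrng K (size (paths_to i))), lpa_mx.
split=> [i|x y i|x y i|].
- by split; [apply: mxrng_simple | apply: mxrng_artinian].
- exact: lpa_mxD.
- exact: lpa_mxM.
exists lpa_of_mx => [x|M]; last first.
  by apply: functional_extensionality_dep => i; apply: lpa_of_mxK.
by apply: lpa_mx_inj => i; rewrite lpa_of_mxK.
Qed.

Lemma finite_acyclic_identity :
  exists e : LPA K E, forall x, rmul e x = x /\ rmul x e = x.
Proof. by exists lpa1 => x; split; [apply: lpa1_mul | apply: lpa_mul1]. Qed.

End Paths.

(** * The equivalences *)

Lemma left_artinian_of_semisimple (R : rngType) (e : R) :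
  (forall x, e ** x = x) -> semisimple R -> left_artinian R.
Proof.
move=> e1 [n [S [phi [simpS phiD phiM phi_bij]]]].
apply: (left_artinian_prod e1 _ phiD phiM phi_bij) => i.
by have [_ []] := simpS i.
Qed.

Lemma finite_uniq_enum (T : choiceType) :
  finite_set [set: T] -> exists s : seq T, uniq s /\ forall x, x \in s.
Proof.
move=> /finite_seqP[s sT]; exists (undup s); split; first exact: undup_uniq.
by move=> x; rewrite mem_undup; have : [set: T] x by []; rewrite sT.
Qed.

(** A graph without vertices has no edges either; its algebra is zero, hence artinian, but has no
    nonzero identity. This is why the equivalence with the unital semisimple case asks for a
    vertex. *)
Theorem theorem5p2 (K : fieldType) (E : digraph) :
  [/\ finite_graph E /\ acyclic E <-> left_artinian (LPA K E),
      left_artinian (LPA K E) <-> right_artinian (LPA K E),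
      right_artinian (LPA K E) <-> artinian (LPA K E) &
      inhabited (vertex E) ->
      (artinian (LPA K E) <-> unital (LPA K E) /\ semisimple (LPA K E))].
Proof.
have lr := lpa_left_right_artinian K E.
have fin_ss : finite_graph E /\ acyclic E ->
    (exists e : LPA K E, forall x, rmul e x = x /\ rmul x e = x) /\
    semisimple (LPA K E).
  move=> [[/finite_uniq_enum[vs [uvs vsP]] fin_es] acE].
  have [es [ues esP]] := finite_uniq_enum fin_es.
  split; first exact: (finite_acyclic_identity K uvs vsP).
  exact: (finite_acyclic_semisimple K uvs ues vsP esP acE).
have right_fin : right_artinian (LPA K E) -> finite_graph E /\ acyclic E.
  move=> art; split; first exact: right_artinian_finite_graph art.
  exact: right_artinian_acyclic art.
split=> //.
- split; last by move/lr.
  move=> /fin_ss[[e eP] ss].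
  by apply: (@left_artinian_of_semisimple _ e) ss => x; case: (eP x).
- by split=> [art|[]//]; split=> //; apply/lr.
move=> [v]; split=> [[_ /right_fin/fin_ss[[e eP] ss]]|].
  (* An identity equal to 0 would kill the vertex [v]. *)
  split=> //; exists e; split=> // e0; case: (@lpaV_neq0 K E v).
  by have [<- _] := eP (lpaV K v); rewrite e0 rmul0r.
move=> [[e [_ eP]] ss]; have art : left_artinian (LPA K E).
  by apply: (@left_artinian_of_semisimple _ e) ss => x; case: (eP x).
by split=> //; apply/lr.
Qed.
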